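(* Let $\theta,\sigma>0$, $\mu_k>0$, $q_k>0$, let $u_k(0)\in\mathbb{R}$, let $\xi_k$ ($k\ge1$) be i.i.d. standard normal random variables, and let $$u_k(t)=u_k(0)e^{-\theta\mu_kt}+\frac{\sigma q_k}{\theta\mu_k}\big(1-e^{-\theta\mu_kt}\big)\xi_k,\qquad U_k(t)=u_k(t)-u_k(0),\qquad t\ge0.$$ Then, for every $t_2>t_1>0$ and every $k=1,2,\ldots$, $$\theta\mu_k=\frac1{t_1}\ln\frac{U_k(t_2-t_1)}{U_k(t_2)-U_k(t_1)}.$$
   Context: The $u_k(t)$ are the Fourier coefficients of the solution of $\dot u+\theta Au=\sigma\sum_k q_k\xi_kh_k$ in a Hilbert space, with $Ah_k=\mu_kh_k$ and $\{h_k\}$ a complete orthonormal system. *)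

(* Defs.v *)
From HB Require Import structures.
From mathcomp Require Import all_boot all_order all_algebra finmap.
From mathcomp Require Import all_classical all_reals all_analysis.

Set Implicit Arguments.
Unset Strict Implicit.
Unset Printing Implicit Defensive.

Import Order.TTheory GRing.Theory Num.Theory.
Import numFieldNormedType.Exports.

Local Open Scope classical_set_scope.
Local Open Scope ring_scope.

Definition standard_normal (d : measure_display) (T : measurableType d)
    (R : realType) (P : probability T R) (X : {RV P >-> R}) : Prop :=
  forall B : set R, measurable B -> distribution P X B = normal_prob 0 1 B.

Definition mutually_independent (d : measure_display) (T : measurableType d)
    (R : realType) (P : probability T R) (I : choiceType) (D : set I)
    (X : I -> {RV P >-> R}) : Prop :=
  forall J : {fset I}, [set` J] `<=` D ->
  forall B : I -> set R, (forall j, measurable (B j)) ->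
  P (\bigcap_(j in [set` J]) (X j @^-1` B j)) =
  (\prod_(j <- J) P (X j @^-1` B j))%E.

(* Sequences k = 1, 2, ... are functions on nat whose value at 0 is never
   used. *)
Definition fourier_coef (T : Type) (R : realType) (theta sigma : R)
    (mu q u0 : nat -> R) (xi : nat -> T -> R) (k : nat) (t : R) (w : T) : R :=
  u0 k * expR (- (theta * mu k * t)) +
  sigma * q k / (theta * mu k) * (1 - expR (- (theta * mu k * t))) * xi k w.

Definition fourier_incr (T : Type) (R : realType) (theta sigma : R)
    (mu q u0 : nat -> R) (xi : nat -> T -> R) (k : nat) (t : R) (w : T) : R :=
  fourier_coef theta sigma mu q u0 xi k t w - u0 k.

(* Main.v *)
(* U_k(t) factors as C_k (1 - e^{-a t}) with a = theta mu_k and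
   C_k = sigma q_k xi_k / a - u_k(0), so the quotient inside the logarithm is
   e^{a t1} whenever C_k != 0. The event C_k = 0 says that xi_k takes one fixed
   value, which is null since xi_k has a density, and the union over k of these
   events is null. *)

Require Import Defs.
From HB Require Import structures.
From mathcomp Require Import all_boot all_order all_algebra finmap.
From mathcomp Require Import all_classical all_reals all_analysis.
From mathcomp Require Import ring.

Import Order.TTheory GRing.Theory Num.Theory.
Import numFieldNormedType.Exports.

Local Open Scope classical_set_scope.
Local Open Scope ring_scope.

(** The exceptional set is the preimage of [[set c]]; its probability is the integral of the
    Gaussian density over a single point, hence zero. *)
Lemma standard_normal_ae_neq (d : measure_display) (T : measurableType d)
    (R : realType) (P : probability T R) (X : {RV P >-> R}) (c : R) :
  standard_normal X -> {ae P, forall w, X w != c}.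
Proof.
move=> X_normal; exists (X @^-1` [set c]); split.
- by rewrite -[X @^-1` _]setTI; exact: measurable_funP.
- rewrite -[LHS]/(distribution P X [set c]) X_normal//.
  exact: (@integral_Sset1 _ _ _ c).
- by move=> w /= /negP; rewrite negbK => /eqP.
Qed.

Lemma fourier_incrE (T : Type) (R : realType) (theta sigma : R)
    (mu q u0 : nat -> R) (xi : nat -> T -> R) (k : nat) (t : R) (w : T) :
  fourier_incr theta sigma mu q u0 xi k t w =
  (sigma * q k / (theta * mu k) * xi k w - u0 k) *
  (1 - expR (- (theta * mu k * t))).
Proof. by rewrite /fourier_incr /fourier_coef; ring. Qed.

(** The denominator is the numerator times [expR (- (a * t1))], by splitting [t2] as
    [(t2 - t1) + t1] in the exponent. *)
Lemma ln_exp_decay_ratio (R : realType) (a C t1 t2 : R) :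
  0 < a -> C != 0 -> t1 < t2 ->
  ln (C * (1 - expR (- (a * (t2 - t1)))) /
      (C * (1 - expR (- (a * t2))) - C * (1 - expR (- (a * t1))))) = a * t1.
Proof.
move=> a_gt0 C_neq0 lt_t12; set D := 1 - expR (- (a * (t2 - t1))).
have D_neq0 : D != 0.
  by rewrite gt_eqF// subr_gt0 expR_lt1 oppr_lt0 mulr_gt0// subr_gt0.
have -> : C * (1 - expR (- (a * t2))) - C * (1 - expR (- (a * t1))) =
          C * D * expR (- (a * t1)).
  have -> : - (a * t2) = - (a * (t2 - t1)) + - (a * t1) by ring.
  by rewrite expRD /D; ring.
by rewrite invfM mulrA divff ?mulf_neq0// mul1r expRN invrK expRK.
Qed.

Theorem theorem3p3 (R : realType) (d : measure_display) (T : measurableType d)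
    (P : probability T R) (theta sigma : R) (mu q u0 : nat -> R)
    (xi : nat -> {RV P >-> R})
    (theta_gt0 : 0 < theta) (sigma_gt0 : 0 < sigma)
    (mu_gt0 : forall k : nat, (1 <= k)%N -> 0 < mu k)
    (q_gt0 : forall k : nat, (1 <= k)%N -> 0 < q k)
    (xi_normal : forall k : nat, (1 <= k)%N -> standard_normal (xi k))
    (xi_indep : mutually_independent [set k : nat | (1 <= k)%N] xi) :
  let U := fourier_incr theta sigma mu q u0 (fun k w => xi k w) in
  {ae P, forall w : T, forall t1 t2 : R, 0 < t1 -> t1 < t2 ->
    forall k : nat, (1 <= k)%N ->
    theta * mu k = 1 / t1 * ln (U k (t2 - t1) w / (U k t2 w - U k t1 w))}.
Proof.
move=> U.
(* The excluded value is the root of [C_k = 0] in [xi k w]. It does not involve time, so one null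
   set serves all [t1] and [t2]. *)
have : {ae P, forall w (k : nat), (1 <= k)%N ->
    xi k w != u0 k * (theta * mu k) / (sigma * q k)}.
  (* Countably many null sets are united; at index 0 the claim is vacuous. *)
  apply/ae_foralln => k; have [k_gt0|_] := boolP (1 <= k)%N; last exact: aeW.
  have := standard_normal_ae_neq _ _ _ _ _
    (u0 k * (theta * mu k) / (sigma * q k)) (xi_normal k k_gt0).
  by apply: filterS => w xi_neq _.
apply: filterS => w xi_neq t1 t2 t1_gt0 lt_t12 k k_gt0.
have a_gt0 : 0 < theta * mu k by rewrite mulr_gt0// mu_gt0.
have b_gt0 : 0 < sigma * q k by rewrite mulr_gt0// q_gt0.
rewrite /U !fourier_incrE ln_exp_decay_ratio//.
  by field; rewrite gt_eqF.
(* If [C_k] vanished, substituting for [u0 k] would force [xi k w] to be the excluded value. *)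
rewrite subr_eq0; apply: contra (xi_neq k k_gt0) => /eqP <-.
by apply/eqP; field; rewrite !gt_eqF// ?q_gt0 ?mu_gt0.
Qed.
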